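(* An algebra $\mathbf{A}=\langle A,\oplus,\odot,\vee,\wedge,0,1\rangle$ is a positive MV-algebra if and only if it is an MV-monoidal algebra which satisfies, for all $x,y,z\in A$: if $x\oplus z=y\oplus z$ and $x\odot z=y\odot z$, then $x=y$.
   Context: MV-algebras are taken in the expanded signature $\{\oplus,\odot,\vee,\wedge,\neg,0,1\}$, where $1=\neg 0$, $x\odot y=\neg(\neg x\oplus\neg y)$, $x\vee y=(x\odot\neg y)\oplus y$, $x\wedge y=\neg(\neg x\vee\neg y)$. A \emph{positive MV-algebra} is an algebra of type $\{\oplus,\odot,\vee,\wedge,0,1\}$ (arities $2,2,2,2,0,0$) isomorphic to a subalgebra of the $\{\oplus,\odot,\vee,\wedge,0,1\}$-reduct of some MV-algebra. An \emph{MV-monoidal algebra} is an algebra $\langle A,\oplus,\odot,\vee,\wedge,0,1\rangle$ (arities $2,2,2,2,0,0$) satisfying: (E1) $\langle A,\vee,\wedge\rangle$ is a distributive lattice; (E2) $\langle A,\oplus,0\rangle$ and $\langle A,\odot,1\rangle$ are commutative monoids; (E3) $\oplus$ and $\odot$ distribute over both $\vee$ and $\wedge$; (E4) $(x\oplus y)\odot((x\odot y)\oplus z)=(x\odot(y\oplus z))\oplus(y\odot z)$; (E5) $(x\odot y)\oplus((x\oplus y)\odot z)=(x\oplus(y\odot z))\odot(y\oplus z)$; (E6) $(x\odot y)\oplus z=((x\oplus y)\odot((x\odot y)\oplus z))\vee z$; (E7) $(x\oplus y)\odot z=((x\odot y)\oplus((x\oplus y)\odot z))\wedge z$. *)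

(* Defs.v *)
(** MV-algebras in the basic signature {oplus, neg, 0}
    (Chang / Cignoli-D'Ottaviano-Mundici axioms). *)
Definition is_MV_algebra {B : Type} (oplus : B -> B -> B) (neg : B -> B) (zero : B) : Prop :=
  (forall x y z, oplus x (oplus y z) = oplus (oplus x y) z) /\
  (forall x y, oplus x y = oplus y x) /\
  (forall x, oplus x zero = x) /\
  (forall x, neg (neg x) = x) /\
  (forall x, oplus x (neg zero) = neg zero) /\
  (forall x y, oplus (neg (oplus (neg x) y)) y = oplus (neg (oplus (neg y) x)) x).

Definition mv_one {B : Type} (neg : B -> B) (zero : B) : B := neg zero.
Definition mv_odot {B : Type} (oplus : B -> B -> B) (neg : B -> B) (x y : B) : B :=
  neg (oplus (neg x) (neg y)).
Definition mv_join {B : Type} (oplus : B -> B -> B) (neg : B -> B) (x y : B) : B :=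
  oplus (mv_odot oplus neg x (neg y)) y.
Definition mv_meet {B : Type} (oplus : B -> B -> B) (neg : B -> B) (x y : B) : B :=
  neg (mv_join oplus neg (neg x) (neg y)).

(** A positive MV-algebra: an algebra of type {oplus, odot, join, meet, 0, 1}
    isomorphic to a subalgebra of the {oplus,odot,join,meet,0,1}-reduct of some
    MV-algebra, i.e. admitting an injective homomorphism (embedding) into such a reduct. *)
Definition positive_MV_algebra {A : Type}
  (oplus odot join meet : A -> A -> A) (zero one : A) : Prop :=
  exists (B : Type) (boplus : B -> B -> B) (bneg : B -> B) (bzero : B) (f : A -> B),
    is_MV_algebra boplus bneg bzero /\
    (forall x y, f x = f y -> x = y) /\
    (forall x y, f (oplus x y) = boplus (f x) (f y)) /\
    (forall x y, f (odot x y) = mv_odot boplus bneg (f x) (f y)) /\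
    (forall x y, f (join x y) = mv_join boplus bneg (f x) (f y)) /\
    (forall x y, f (meet x y) = mv_meet boplus bneg (f x) (f y)) /\
    f zero = bzero /\
    f one = mv_one bneg bzero.

Definition is_MV_monoidal {A : Type}
  (oplus odot join meet : A -> A -> A) (zero one : A) : Prop :=
  (forall x y z, join x (join y z) = join (join x y) z) /\
  (forall x y z, meet x (meet y z) = meet (meet x y) z) /\
  (forall x y, join x y = join y x) /\
  (forall x y, meet x y = meet y x) /\
  (forall x y, join x (meet x y) = x) /\
  (forall x y, meet x (join x y) = x) /\
  (forall x y z, meet x (join y z) = join (meet x y) (meet x z)) /\
  (forall x y z, oplus x (oplus y z) = oplus (oplus x y) z) /\
  (forall x y, oplus x y = oplus y x) /\
  (forall x, oplus x zero = x) /\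
  (forall x y z, odot x (odot y z) = odot (odot x y) z) /\
  (forall x y, odot x y = odot y x) /\
  (forall x, odot x one = x) /\
  (forall x y z, oplus x (join y z) = join (oplus x y) (oplus x z)) /\
  (forall x y z, oplus x (meet y z) = meet (oplus x y) (oplus x z)) /\
  (forall x y z, odot x (join y z) = join (odot x y) (odot x z)) /\
  (forall x y z, odot x (meet y z) = meet (odot x y) (odot x z)) /\
  (forall x y z, odot (oplus x y) (oplus (odot x y) z)
                 = oplus (odot x (oplus y z)) (odot y z)) /\
  (forall x y z, oplus (odot x y) (odot (oplus x y) z)
                 = odot (oplus x (odot y z)) (oplus y z)) /\
  (forall x y z, oplus (odot x y) z
                 = join (odot (oplus x y) (oplus (odot x y) z)) z) /\
  (forall x y z, odot (oplus x y) z
                 = meet (oplus (odot x y) (odot (oplus x y) z)) z).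

(* Main.v *)
(* In an MV-algebra, (E4)-(E7) follow by residuation, where the case distinction
   available in a chain is replaced by [mv_le_cases], an instance of prelinearity.
   Cancellation holds since x = (¬z ⊙ (x ⊕ z)) ⊕ (x ⊙ z).

   Conversely, a formal good_sum a_1 + ... + a_n of elements of A is determined by its
   truncations ((a_1 + ... + a_n - k) ∨ 0) ∧ 1, which form a good sequence in A
   (s_k ⊕ s_{k+1} = s_k and s_k ⊙ s_{k+1} = s_{k+1}); adding a summand a turns s into
   the sequence s_k ⊕ (s_{k-1} ⊙ a). By (E4) and (E5) the order of the summands is
   immaterial, and by (E6) and (E7) adding a preserves meets and determines s_k ⊕ a
   and s_k ⊙ a. Hence, under the cancellation hypothesis, the sums form a cancellative
   commutative monoid with a compatible semilattice order, and A embeds into the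
   interval [0, 1] of its group of differences, which is an MV-algebra. *)

Require Import Defs.
From Stdlib Require Import ssreflect List Permutation Lia.
From Stdlib Require Import ProofIrrelevance ClassicalEpsilon.
From Stdlib Require Import FunctionalExtensionality PropExtensionality.
Import ListNotations.

(** * MV-algebras satisfy the axioms of MV-monoidal algebras and cancellation *)

Section MVAlgebra.

Context {B : Type} {oplus : B -> B -> B} {neg : B -> B} {zero : B}.
Context (mvB : is_MV_algebra oplus neg zero).

Local Notation odot := (mv_odot oplus neg).
Local Notation join := (mv_join oplus neg).
Local Notation meet := (mv_meet oplus neg).
Local Notation one := (mv_one neg zero).
Local Notation "x ⊕ y" := (oplus x y) (at level 50, left associativity).
Local Notation "x ⊙ y" := (odot x y) (at level 40, left associativity).
Local Notation "¬ x" := (neg x) (at level 35, right associativity).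

Lemma mv_addA x y z : x ⊕ (y ⊕ z) = x ⊕ y ⊕ z.
Proof. by case: mvB. Qed.
Lemma mv_addC x y : x ⊕ y = y ⊕ x.
Proof. by case: mvB => _ []. Qed.
Lemma mv_addx0 x : x ⊕ zero = x.
Proof. by case: mvB => _ [_ []]. Qed.
Lemma mv_negK x : ¬ ¬ x = x.
Proof. by case: mvB => _ [_ [_ []]]. Qed.
Lemma mv_addx1 x : x ⊕ one = one.
Proof. by case: mvB => _ [_ [_ [_ []]]]. Qed.
Lemma mv_addNN x y : ¬ (¬ x ⊕ y) ⊕ y = ¬ (¬ y ⊕ x) ⊕ x.
Proof. by case: mvB => _ [_ [_ [_ []]]]. Qed.

Lemma mv_add0x x : zero ⊕ x = x.
Proof. by rewrite mv_addC mv_addx0. Qed.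
Lemma mv_neg1 : ¬ one = zero.
Proof. exact: mv_negK. Qed.
Lemma mv_addAC x y z : x ⊕ y ⊕ z = x ⊕ z ⊕ y.
Proof. by rewrite -!mv_addA (mv_addC y). Qed.
Lemma mv_addNx x : ¬ x ⊕ x = one.
Proof. by have := mv_addNN x one; rewrite mv_addx1 mv_neg1 !mv_add0x. Qed.

(** * The natural order and residuation *)

Definition mv_le x y := ¬ x ⊕ y = one.
Local Notation "x ≤ y" := (mv_le x y) (at level 70, no associativity).

Lemma mv_lexx x : x ≤ x.
Proof. exact: mv_addNx. Qed.

Lemma mv_le_anti x y : x ≤ y -> y ≤ x -> x = y.
Proof.
rewrite /mv_le => xy yx; have := mv_addNN x y.
by rewrite xy yx mv_neg1 !mv_add0x.
Qed.

Lemma mv_le_addr x z : x ≤ x ⊕ z.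
Proof. by rewrite /mv_le mv_addA mv_addNx mv_addC mv_addx1. Qed.

Lemma mv_le_addl x z : x ≤ z ⊕ x.
Proof. by rewrite mv_addC; apply: mv_le_addr. Qed.

(** The term [¬ (¬ y ⊕ x)] is the truncated difference [y ⊖ x], and the Łukasiewicz axiom allows it
    to be added back. Thus the order is divisibility for [⊕]. *)
Lemma mv_le_subK x y : x ≤ y -> y = x ⊕ ¬ (¬ y ⊕ x).
Proof.
by rewrite /mv_le => xy; rewrite (mv_addC x) -mv_addNN xy mv_neg1 mv_add0x.
Qed.

Lemma mv_leP x y : x ≤ y -> exists z, y = x ⊕ z.
Proof. by move=> /mv_le_subK xy; exists (¬ (¬ y ⊕ x)). Qed.

Lemma mv_le_trans y x z : x ≤ y -> y ≤ z -> x ≤ z.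
Proof.
move=> /mv_leP[u ->] /mv_leP[v ->]; rewrite -mv_addA; exact: mv_le_addr.
Qed.

Lemma mv_add_le x x' y y' : x ≤ x' -> y ≤ y' -> x ⊕ y ≤ x' ⊕ y'.
Proof.
move=> /mv_leP[u ->] /mv_leP[v ->].
rewrite mv_addA (mv_addAC x u) -mv_addA; exact: mv_le_addr.
Qed.

Lemma mv_le_neg x y : x ≤ y -> ¬ y ≤ ¬ x.
Proof. by rewrite /mv_le mv_negK mv_addC. Qed.

Lemma mv_neg_le x y : ¬ x ≤ ¬ y -> y ≤ x.
Proof. by move=> /mv_le_neg; rewrite !mv_negK. Qed.

Lemma mv_le0x x : zero ≤ x.
Proof. by have := mv_le_addr zero x; rewrite mv_add0x. Qed.

Lemma mv_mulC x y : x ⊙ y = y ⊙ x.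
Proof. by rewrite /mv_odot mv_addC. Qed.
Lemma mv_mulA x y z : x ⊙ (y ⊙ z) = x ⊙ y ⊙ z.
Proof. by rewrite /mv_odot !mv_negK mv_addA. Qed.
Lemma mv_negD x y : ¬ (x ⊕ y) = ¬ x ⊙ ¬ y.
Proof. by rewrite /mv_odot !mv_negK. Qed.
Lemma mv_negM x y : ¬ (x ⊙ y) = ¬ x ⊕ ¬ y.
Proof. exact: mv_negK. Qed.

Lemma mv_mul_le x x' y y' : x ≤ x' -> y ≤ y' -> x ⊙ y ≤ x' ⊙ y'.
Proof. by move=> *; apply/mv_le_neg/mv_add_le; apply: mv_le_neg. Qed.

(** Both inequalities unfold to the statement that [¬ x ⊕ ¬ y ⊕ z] is [one]. *)
Lemma mv_residual x y z : y ⊙ x ≤ z <-> x ≤ ¬ y ⊕ z.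
Proof. by rewrite /mv_le mv_negM mv_addA (mv_addC (¬ x)). Qed.

Lemma mv_mul_ler x y : x ⊙ y ≤ y.
Proof. by apply/mv_residual; apply: mv_le_addl. Qed.

Lemma mv_le_addNM x y : x ≤ ¬ y ⊕ (y ⊙ x).
Proof. by apply/mv_residual; apply: mv_lexx. Qed.

(** * Lattice operations and distributivity *)

Lemma mv_joinC x y : join x y = join y x.
Proof. by rewrite /mv_join /mv_odot !mv_negK mv_addNN. Qed.

Lemma mv_le_joinr x y : y ≤ join x y.
Proof. exact: mv_le_addl. Qed.

Lemma mv_le_joinl x y : x ≤ join x y.
Proof. by rewrite mv_joinC; apply: mv_le_joinr. Qed.

(** Since [z = y ⊕ (z ⊖ y)], it suffices that [x ⊖ y ≤ z ⊖ y], which is monotonicity of [⊙]. *)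
Lemma mv_join_le x y z : x ≤ z -> y ≤ z -> join x y ≤ z.
Proof.
move=> xz /mv_le_subK zE; rewrite zE /mv_join (mv_addC y).
apply: mv_add_le (mv_lexx _); rewrite mv_negD mv_negK mv_mulC.
by rewrite (mv_mulC z); apply: mv_mul_le (mv_lexx _) _.
Qed.

Lemma mv_negJ x y : ¬ join x y = meet (¬ x) (¬ y).
Proof. by rewrite /mv_meet !mv_negK. Qed.
Lemma mv_negI x y : ¬ meet x y = join (¬ x) (¬ y).
Proof. exact: mv_negK. Qed.

Lemma mv_meet_lel x y : meet x y ≤ x.
Proof. by apply: mv_neg_le; rewrite mv_negI; apply: mv_le_joinl. Qed.

Lemma mv_meet_ler x y : meet x y ≤ y.
Proof. by apply: mv_neg_le; rewrite mv_negI; apply: mv_le_joinr. Qed.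

Lemma mv_le_meet x y z : z ≤ x -> z ≤ y -> z ≤ meet x y.
Proof.
by move=> *; apply: mv_neg_le; rewrite mv_negI; apply: mv_join_le; apply: mv_le_neg.
Qed.

Lemma mv_meetC x y : meet x y = meet y x.
Proof. by rewrite /mv_meet mv_joinC. Qed.

Lemma mv_joinA x y z : join x (join y z) = join (join x y) z.
Proof.
apply: mv_le_anti; repeat apply: mv_join_le.
- by apply: mv_le_trans (mv_le_joinl _ _); apply: mv_le_joinl.
- by apply: mv_le_trans (mv_le_joinl _ _); apply: mv_le_joinr.
- exact: mv_le_joinr.
- exact: mv_le_joinl.
- by apply: mv_le_trans (mv_le_joinr _ _); apply: mv_le_joinl.
- by apply: mv_le_trans (mv_le_joinr _ _); apply: mv_le_joinr.
Qed.

Lemma mv_meetA x y z : meet x (meet y z) = meet (meet x y) z.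
Proof. by rewrite /mv_meet !mv_negK mv_joinA. Qed.

Lemma mv_joinKI x y : join x (meet x y) = x.
Proof.
apply: mv_le_anti (mv_le_joinl _ _); apply: mv_join_le (mv_lexx _) _.
exact: mv_meet_lel.
Qed.

Lemma mv_meetKU x y : meet x (join x y) = x.
Proof.
apply: mv_le_anti (mv_meet_lel _ _) _; apply: mv_le_meet (mv_lexx _) _.
exact: mv_le_joinl.
Qed.

Lemma mv_mulU x y z : x ⊙ join y z = join (x ⊙ y) (x ⊙ z).
Proof.
apply: mv_le_anti.
- by apply/mv_residual; apply: mv_join_le; apply/mv_residual;
    [apply: mv_le_joinl | apply: mv_le_joinr].
- by apply: mv_join_le; apply: mv_mul_le (mv_lexx _) _;
    [apply: mv_le_joinl | apply: mv_le_joinr].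
Qed.

Lemma mv_addI x y z : x ⊕ meet y z = meet (x ⊕ y) (x ⊕ z).
Proof.
have := f_equal neg (mv_mulU (¬ x) (¬ y) (¬ z)).
by rewrite mv_negM !mv_negJ !mv_negM !mv_negK.
Qed.

Lemma mv_meetE x y : meet x y = x ⊙ (¬ x ⊕ y).
Proof.
by rewrite mv_meetC /mv_meet /mv_join mv_negD mv_negM !mv_negK mv_mulC
  (mv_addC y).
Qed.

(** With [w = join y z], the left side is [w ⊙ (¬ w ⊕ x)]. Here [⊙] distributes over the join, and
    [¬ w ⊕ x] can only grow when [w] is lowered to [y] or to [z]. *)
Lemma mv_meetU x y z : meet x (join y z) = join (meet x y) (meet x z).
Proof.
apply: mv_le_anti.
- rewrite mv_meetC mv_meetE mv_mulC mv_mulU.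
  apply: mv_join_le.
  + apply: mv_le_trans (mv_le_joinl _ _); rewrite mv_mulC mv_meetC mv_meetE.
    apply: mv_mul_le (mv_lexx _) (mv_add_le _ _ _ _ _ (mv_lexx _)).
    by apply: mv_le_neg; apply: mv_le_joinl.
  + apply: mv_le_trans (mv_le_joinr _ _); rewrite mv_mulC (mv_meetC x z) mv_meetE.
    apply: mv_mul_le (mv_lexx _) (mv_add_le _ _ _ _ _ (mv_lexx _)).
    by apply: mv_le_neg; apply: mv_le_joinr.
- by apply: mv_join_le; apply: mv_le_meet (mv_meet_lel _ _) (mv_le_trans _ _ _ (mv_meet_ler _ _) _);
    [apply: mv_le_joinl | apply: mv_le_joinr].
Qed.

(** * Prelinearity as a substitute for chains *)

Lemma mv_mulNx x : ¬ x ⊙ x = zero.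
Proof. by rewrite -mv_neg1 -(mv_addNx (¬ x)). Qed.

Lemma mv_meet_decomp x y : meet x y ⊕ (x ⊙ ¬ y) = x.
Proof.
rewrite [RHS](mv_le_subK _ _ (mv_meet_lel x y)); congr (_ ⊕ _).
rewrite mv_negD mv_negK mv_negI mv_mulU (mv_mulC x (¬ x)) mv_mulNx.
by apply: mv_le_anti; [apply: mv_le_joinr | apply: mv_join_le (mv_le0x _) (mv_lexx _)].
Qed.

(** Adding [c] to [m = meet x y] gives an element below both [x] and [y], so [m ⊕ c ≤ m]. As
    [c ≤ ¬ m], it follows that [c ≤ ¬ m ⊙ (m ⊕ c) ≤ ¬ m ⊙ m = zero]. *)
Lemma mv_prelinear x y : meet (x ⊙ ¬ y) (y ⊙ ¬ x) = zero.
Proof.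
set m := meet x y; set c := meet _ _.
have mc : m ⊕ c ≤ m.
  apply: mv_le_meet.
    rewrite -[X in _ ≤ X](mv_meet_decomp x y); apply: mv_add_le (mv_lexx _) _.
    exact: mv_meet_lel.
  rewrite -[X in _ ≤ X](mv_meet_decomp y x) (mv_meetC y).
  by apply: mv_add_le (mv_lexx _) _; apply: mv_meet_ler.
apply: mv_le_anti (mv_le0x _); rewrite -(mv_mulNx m).
apply: mv_le_trans (mv_mul_le _ _ _ _ (mv_lexx _) mc).
have := mv_meetE (¬ m) c; rewrite mv_negK => <-.
apply: mv_le_meet (mv_lexx _); apply: mv_le_trans (mv_meet_lel _ _) _.
apply: mv_le_trans (mv_mul_ler _ _) (mv_le_neg _ _ _); exact: mv_meet_ler.
Qed.

(* In an MV-chain one of [v], [w] is [zero]: this replaces the case distinction. *)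
Lemma mv_le_cases v w t r : meet v w = zero -> t ≤ v ⊕ r -> t ≤ w ⊕ r -> t ≤ r.
Proof.
move=> vw tv tw; rewrite -(mv_addx0 r) -vw mv_addI.
by apply: mv_le_meet; rewrite mv_addC.
Qed.

(** Prelinearity for [x] and [¬ y]; in a chain it says that [x ⊕ y] is [one] or [x ⊙ y] is
    [zero]. *)
Lemma mv_prelinearD x y : meet (¬ (x ⊕ y)) (x ⊙ y) = zero.
Proof.
have := mv_prelinear x (¬ y).
by rewrite mv_negK mv_negD mv_meetC (mv_mulC (¬ y)).
Qed.

Lemma mv_addU x y z : x ⊕ join y z = join (x ⊕ y) (x ⊕ z).
Proof.
apply: mv_le_anti; last first.
  by apply: mv_join_le; apply: mv_add_le (mv_lexx _) _;
    [apply: mv_le_joinl | apply: mv_le_joinr].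
apply: (mv_le_cases _ _ _ _ (mv_prelinear y z)).
- apply: mv_le_trans (mv_add_le _ _ _ _ (mv_lexx _) (mv_le_joinr (x ⊕ y) _)).
  rewrite mv_addA (mv_addC _ x) -mv_addA; exact: mv_lexx.
- apply: mv_le_trans (mv_add_le _ _ _ _ (mv_lexx _) (mv_le_joinl _ (x ⊕ z))).
  rewrite mv_addA (mv_addC _ x) -mv_addA mv_joinC; exact: mv_lexx.
Qed.

Lemma mv_mulI x y z : x ⊙ meet y z = meet (x ⊙ y) (x ⊙ z).
Proof.
rewrite -[LHS]mv_negK mv_negM mv_negI mv_addU mv_negJ.
by rewrite !mv_negD !mv_negK.
Qed.

(** * The axioms (E4) to (E7) in an MV-algebra *)

Lemma mv_add_mulE x y z :
  x ⊙ y ⊕ z = join ((x ⊕ y) ⊙ (x ⊙ y ⊕ z)) z.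
Proof.
apply: mv_le_anti; last first.
  by apply: mv_join_le (mv_mul_ler _ _) _; apply: mv_le_addl.
apply: (mv_le_cases _ _ _ _ (mv_prelinearD x y)).
- by apply/mv_residual; apply: mv_le_joinl.
- by apply: mv_add_le (mv_lexx _) _; apply: mv_le_joinr.
Qed.

Lemma mv_mul_addE x y z :
  (x ⊕ y) ⊙ z = meet (x ⊙ y ⊕ (x ⊕ y) ⊙ z) z.
Proof.
have := f_equal neg (mv_add_mulE (¬ x) (¬ y) (¬ z)).
rewrite mv_negJ.
by rewrite !(mv_negD, mv_negM) !mv_negK.
Qed.

(** One inequality is residuation. For the other, in a chain both sides equal [x ⊙ y ⊕ z] if [x ⊕ y]
    is [one], and [(x ⊕ y) ⊙ z] if [x ⊙ y] is [zero]. *)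
Lemma mv_good_pair x y z :
  (x ⊕ y) ⊙ (x ⊙ y ⊕ z) = (x ⊕ y) ⊙ z ⊕ x ⊙ y.
Proof.
apply: mv_le_anti; first (apply/mv_residual; rewrite mv_addA (mv_addC (x ⊙ y))).
  by apply: mv_add_le (mv_le_addNM _ _) (mv_lexx _).
apply: (mv_le_cases _ _ _ _ (mv_prelinearD x y)).
- apply: mv_le_trans (mv_le_addNM _ _); rewrite mv_addC.
  by apply: mv_add_le (mv_lexx _) (mv_mul_ler _ _).
- rewrite mv_addC; apply: mv_add_le (mv_lexx _) _.
  by apply: mv_mul_le (mv_lexx _) (mv_le_addl _ _).
Qed.

(** Both sides are the join of [x] and [¬ y]. *)
Lemma mv_addN_mul x y : ¬ y ⊕ x ⊙ y = ¬ (x ⊕ y) ⊕ x.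
Proof.
have := mv_joinC x (¬ y); rewrite /mv_join mv_negK mv_addC => ->.
by rewrite mv_negD (mv_mulC (¬ x)).
Qed.

(** This bound serves both cases of [mv_add_assoc_half], which splits on [x] and [y]; its own proof
    splits on [y] and [z]. *)
Lemma mv_add_assoc_le x y z :
  z ⊕ x ⊙ y ≤ ¬ (x ⊕ y) ⊕ ((y ⊕ z) ⊙ x ⊕ y ⊙ z).
Proof.
set M := (y ⊕ z) ⊙ x; set v := ¬ (x ⊕ y); set w' := y ⊙ z.
apply: (mv_le_cases _ _ _ _ (mv_prelinearD y z)).
- apply: (mv_le_trans (v ⊕ x ⊕ w')).
    rewrite -mv_addN_mul mv_addAC.
    by apply: mv_add_le (mv_le_addNM _ _) (mv_lexx _).
  rewrite -mv_addA [X in _ ≤ X]mv_addA (mv_addC _ v) -mv_addA.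
  apply: mv_add_le (mv_lexx _) _; rewrite mv_addA.
  by apply: mv_add_le (mv_le_addNM _ _) (mv_lexx _).
- apply: (mv_le_trans (w' ⊕ (v ⊕ M))); last first.
    by apply: mv_add_le (mv_lexx _) _; rewrite mv_addA; apply: mv_le_addr.
  rewrite -{1}(mv_meet_decomp z (¬ y)) mv_negK (mv_mulC z) (mv_addC _ w') -mv_addA.
  apply: mv_add_le (mv_lexx _) _.
  (* After [y ⊙ z] is split off from [z], the rest [c] of the left side lies below [y ⊕ z]. Hence it
     is [(y ⊕ z) ⊙ (¬ (y ⊕ z) ⊕ c)], whose second factor turns out to be [v ⊕ x]. *)
  set c := meet z (¬ y) ⊕ x ⊙ y.
  have cy : c ≤ y ⊕ z.
    rewrite mv_addC; apply: mv_add_le (mv_meet_lel _ _) (mv_mul_ler _ _).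
  have cx : ¬ (y ⊕ z) ⊕ c = v ⊕ x.
    by rewrite -mv_addN_mul mv_addA mv_negD mv_meetC (mv_addC _ (meet _ _)) mv_meet_decomp.
  apply: (mv_le_trans _ _ _ (mv_le_meet _ _ _ cy (mv_lexx _))).
  rewrite mv_meetE cx; apply/mv_residual.
  rewrite mv_addA (mv_addC _ v) -mv_addA.
  exact: mv_add_le (mv_lexx _) (mv_le_addNM _ _).
Qed.

Lemma mv_add_assoc_half x y z :
  (x ⊕ y) ⊙ z ⊕ x ⊙ y ≤ (y ⊕ z) ⊙ x ⊕ y ⊙ z.
Proof.
have K := mv_add_assoc_le x y z.
apply: (mv_le_cases _ _ _ _ (mv_prelinearD x y)).
- by apply: mv_le_trans K; apply: mv_add_le (mv_mul_ler _ _) (mv_lexx _).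
- rewrite mv_addC; apply: mv_add_le (mv_lexx _) _; apply/mv_residual.
  by apply: mv_le_trans K; apply: mv_le_addr.
Qed.

(** Exchanging [x] and [z] swaps the two sides, so one inequality is enough. *)
Lemma mv_add_mul_assoc x y z :
  (x ⊕ y) ⊙ (x ⊙ y ⊕ z) = x ⊙ (y ⊕ z) ⊕ y ⊙ z.
Proof.
rewrite mv_good_pair (mv_mulC x (y ⊕ z)).
apply: mv_le_anti (mv_add_assoc_half _ _ _) _.
have := mv_add_assoc_half z y x.
by rewrite !(mv_addC z) !(mv_mulC z) (mv_addC y x) (mv_mulC y x).
Qed.

Lemma mv_mul_add_assoc x y z :
  x ⊙ y ⊕ (x ⊕ y) ⊙ z = (x ⊕ y ⊙ z) ⊙ (y ⊕ z).
Proof.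
have := f_equal neg (mv_add_mul_assoc (¬ x) (¬ y) (¬ z)).
by rewrite !(mv_negD, mv_negM) !mv_negK.
Qed.

Lemma mv_is_MV_monoidal : is_MV_monoidal oplus odot join meet zero one.
Proof.
have mulx1 x : x ⊙ one = x by rewrite /mv_odot mv_neg1 mv_addx0 mv_negK.
do !split.
- exact: mv_joinA.
- exact: mv_meetA.
- exact: mv_joinC.
- exact: mv_meetC.
- exact: mv_joinKI.
- exact: mv_meetKU.
- exact: mv_meetU.
- exact: mv_addA.
- exact: mv_addC.
- exact: mv_addx0.
- exact: mv_mulA.
- exact: mv_mulC.
- exact: mulx1.
- exact: mv_addU.
- exact: mv_addI.
- exact: mv_mulU.
- exact: mv_mulI.
- exact: mv_add_mul_assoc.
- exact: mv_mul_add_assoc.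
- exact: mv_add_mulE.
- exact: mv_mul_addE.
Qed.

Lemma mv_add_mul_cancel x y z : x ⊕ z = y ⊕ z -> x ⊙ z = y ⊙ z -> x = y.
Proof.
have E a : a = ¬ z ⊙ (a ⊕ z) ⊕ a ⊙ z.
  by rewrite -[LHS](mv_meet_decomp a (¬ z)) mv_meetC mv_meetE mv_negK (mv_addC z).
by move=> xyA xyM; rewrite (E x) xyA xyM -E.
Qed.

End MVAlgebra.

(** * Unit intervals of lattice-ordered Abelian groups *)

Section UnitInterval.

Context {G : Type} {add meet : G -> G -> G} {opp : G -> G} {zero u : G}.
Local Notation "x + y" := (add x y) (at level 50, left associativity).
Local Notation "- x" := (opp x) (at level 35, right associativity).
Local Notation "x ∧ y" := (meet x y) (at level 40, left associativity).
Context (addA : forall x y z, x + (y + z) = x + y + z).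
Context (addC : forall x y, x + y = y + x).
Context (addx0 : forall x, x + zero = x).
Context (addxN : forall x, x + - x = zero).
Context (meetA : forall x y z, x ∧ (y ∧ z) = x ∧ y ∧ z).
Context (meetC : forall x y, x ∧ y = y ∧ x).
Context (meetxx : forall x, x ∧ x = x).
Context (add_meet : forall x y z, x + (y ∧ z) = (x + y) ∧ (x + z)).
Context (zero_le_u : zero ∧ u = zero).

Lemma group_add0x x : zero + x = x.
Proof. by rewrite addC addx0. Qed.

Lemma group_addK x y : x + y + - y = x.
Proof. by rewrite -addA addxN addx0. Qed.

Lemma group_subK x y : x + - y + y = x.
Proof. by rewrite -addA (addC _ y) addxN addx0. Qed.

Lemma group_addI x y z : x + z = y + z -> x = y.
Proof. by move=> xyz; rewrite -(group_addK x z) xyz group_addK. Qed.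

Lemma group_addKC x y : x + (y + - x) = y.
Proof. by rewrite addC group_subK. Qed.

Lemma group_addAC x y z : x + y + z = x + z + y.
Proof. by rewrite -!addA (addC y). Qed.

Lemma group_subKK x y : x + - (x + - y) = y.
Proof. by apply: (group_addI _ _ (x + - y)); rewrite group_subK group_addKC. Qed.

Lemma meet_add x y z : (x ∧ y) + z = (x + z) ∧ (y + z).
Proof. by rewrite !(addC _ z) add_meet. Qed.

(** * The MV-algebra on the interval *)

Definition in_interval x := zero ∧ x = zero /\ x ∧ u = x.

Lemma add_in_interval x y : in_interval x -> in_interval y -> in_interval ((x + y) ∧ u).
Proof.
move=> [x0 _] [y0 _]; split; last by rewrite -meetA meetxx.
have yxy : y ∧ (x + y) = y by rewrite -{1}(group_add0x y) -meet_add x0 group_add0x.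
by rewrite meetA -{1}y0 -(meetA _ y) yxy y0.
Qed.

Lemma opp_in_interval x : in_interval x -> in_interval (u + - x).
Proof.
move=> [x0 xu]; split; apply: (group_addI _ _ x); rewrite meet_add group_subK.
  by rewrite group_add0x xu.
by rewrite -{1}(group_add0x u) (addC zero) -add_meet x0 addx0.
Qed.

Definition interval := {x | in_interval x}.

Definition interval_add (x y : interval) : interval :=
  exist _ _ (add_in_interval _ _ (proj2_sig x) (proj2_sig y)).
Definition interval_neg (x : interval) : interval :=
  exist _ _ (opp_in_interval _ (proj2_sig x)).
Definition interval_zero : interval :=
  exist _ zero (conj (meetxx zero) zero_le_u).

Local Notation val := (@proj1_sig G in_interval).

Lemma interval_inj (x y : interval) : val x = val y -> x = y.
Proof.
case: x y => [x xP] [y yP] /= xy; subst y; congr exist; exact: proof_irrelevance.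
Qed.

(** The truncated difference, the positive part of [x - y], is expressed through the meet because
    the group is presented without a join. *)
Lemma interval_subE (x y : interval) :
  val (interval_neg (interval_add (interval_neg x) y)) = val x + - (val x ∧ val y).
Proof.
case: x y => [x xP] [y yP] /=.
rewrite -{3}(group_subK u x) -add_meet (meetC y).
apply: (group_addI _ _ (u + - x + (x ∧ y))); rewrite group_subK.
by rewrite (addC _ (x ∧ y)) addA group_subK group_addKC.
Qed.

(** The right side is symmetric in [x] and [y], which yields the Łukasiewicz axiom for the
    interval. *)
Lemma interval_joinE (x y : interval) :
  val (interval_add (interval_neg (interval_add (interval_neg x) y)) y) =
  (val x + val y + - (val x ∧ val y)) ∧ u.
Proof.
by rewrite -[LHS]/((val (interval_neg _) + val y) ∧ u) interval_subE group_addAC.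
Qed.

Lemma interval_MV : is_MV_algebra interval_add interval_neg interval_zero.
Proof.
split; [|split; [|split; [|split; [|split]]]].
- move=> x y z; apply: interval_inj => /=.
  (* An inner truncation is harmless under an outer one, because the other summand is
     nonnegative. *)
  have absorb a b : in_interval a -> (a + (b ∧ u)) ∧ u = (a + b) ∧ u.
    move=> [a0 _]; rewrite add_meet -meetA; congr (_ ∧ _).
    by rewrite -{2}(group_add0x u) -meet_add (meetC a) a0 group_add0x.
  rewrite (absorb _ _ (proj2_sig x)) (addC (_ ∧ _)) (absorb _ _ (proj2_sig z)).
  by rewrite (addC (val z)) addA.
- by move=> x y; apply: interval_inj; rewrite /= addC.
- by case=> x xP; apply: interval_inj; rewrite /= addx0; case: xP.
- by move=> x; apply: interval_inj; rewrite /= group_subKK.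
- case=> x xP; apply: interval_inj => /=.
  have -> : - zero = zero by rewrite -[LHS]group_add0x addxN.
  rewrite addx0 -{2 3}(group_add0x u) -meet_add meetC.
  by case: xP => ->.
- by move=> x y; apply: interval_inj; rewrite !interval_joinE (addC (val x)) (meetC (val x)).
Qed.

(** In the interval, [⊙] is the excess [q] of the group sum over its truncation [p]. *)
Lemma interval_odotE (x y : interval) (p q : G) :
  p = (val x + val y) ∧ u -> val x + val y = p + q ->
  val (mv_odot interval_add interval_neg x y) = q.
Proof.
case: x y => [x xP] [y yP] /= pE xyE.
suff -> : (u + - x + (u + - y)) ∧ u = u + - q by rewrite group_subKK.
apply: (group_addI _ _ (x + y)); rewrite meet_add.
have -> : u + - x + (u + - y) + (x + y) = u + u.
  by rewrite (addC x y) -addA (addA (u + - y)) group_subK (addC u x) addA group_subK.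
by rewrite -add_meet meetC -pE xyE (addC p q) addA group_subK.
Qed.

(** Cancellation in the group lets the two sum identities determine the images of [aodot] and
    [ajoin] from those of [aoplus] and [ameet]. *)
Lemma positive_of_group_embedding (A : Type)
    (aoplus aodot ajoin ameet : A -> A -> A) (azero aone : A) (f : A -> G) :
  (forall x y, f x = f y -> x = y) ->
  (forall x, in_interval (f x)) ->
  f azero = zero -> f aone = u ->
  (forall x y, f (aoplus x y) = (f x + f y) ∧ u) ->
  (forall x y, f x + f y = f (aoplus x y) + f (aodot x y)) ->
  (forall x y, f (ameet x y) = f x ∧ f y) ->
  (forall x y, f x + f y = f (ajoin x y) + f (ameet x y)) ->
  positive_MV_algebra aoplus aodot ajoin ameet azero aone.
Proof.
move=> f_inj f_in f0 f1 fD fDM fI fUI.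
exists interval, interval_add, interval_neg, interval_zero, (fun x => exist _ _ (f_in x)).
have mvB := interval_MV; have negK := mv_negK mvB.
split; [exact: mvB|split; [|split; [|split; [|split; [|split; [|split]]]]]].
- by move=> x y [/f_inj].
- by move=> x y; apply: interval_inj; rewrite /= fD.
- move=> x y; apply: interval_inj; symmetry.
  by apply: (interval_odotE _ _ (f (aoplus x y))); rewrite /= ?fD // -fD.
- move=> x y; apply: interval_inj.
  rewrite /mv_join /mv_odot negK interval_joinE /= fUI fI group_addK.
  by case: (f_in (ajoin x y)).
(* By [mv_meetE] the meet is [x ⊖ (x ⊖ y)], so [interval_subE] applies twice. *)
- move=> x y; apply: interval_inj; rewrite (mv_meetE mvB) /mv_odot interval_subE.
  set z := interval_add _ _.
  rewrite -[interval_neg z]/(interval_neg (interval_add _ _)) interval_subE /= -fI.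
  have -> : f x ∧ (f x + - f (ameet x y)) = f x + - f (ameet x y).
    apply: (group_addI _ _ (f (ameet x y))); rewrite meet_add group_subK.
    by rewrite -{2}(addx0 (f x)) -add_meet meetC (proj1 (f_in _)) addx0.
  by rewrite group_subKK.
- exact: interval_inj.
- apply: interval_inj; rewrite /= f1.
  by apply: (group_addI _ _ zero); rewrite group_subK addx0.
Qed.

End UnitInterval.

(** * Quotients by an equivalence relation *)

Section Quotient.

Context {T : Type} (R : T -> T -> Prop) (t0 : T).
Context (R_refl : forall x, R x x).
Context (R_sym : forall x y, R x y -> R y x).
Context (R_trans : forall x y z, R x y -> R y z -> R x z).

(** The choice depends only on the predicate [R x]. Related elements have equal predicates by
    extensionality, so they share one representative. *)
Definition canon x := epsilon (inhabits t0) (R x).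

Lemma canonP x : R x (canon x).
Proof. by apply: epsilon_spec; exists x; apply: R_refl. Qed.

Lemma canon_eq x y : R x y -> canon x = canon y.
Proof.
move=> xy; congr epsilon; apply: functional_extensionality => z.
apply: propositional_extensionality; split; first exact/R_trans/R_sym.
exact: R_trans.
Qed.

Definition quotient := {x | canon x = x}.
Definition rep : quotient -> T := @proj1_sig T _.
Definition class x : quotient :=
  exist _ (canon x) (eq_sym (canon_eq _ _ (canonP x))).

Lemma rep_class x : R (rep (class x)) x.
Proof. exact/R_sym/canonP. Qed.

Lemma class_rep q : class (rep q) = q.
Proof.
case: q => x xE; rewrite /class /=.
by move: (eq_sym _) => /=; rewrite xE => e; congr exist; apply: proof_irrelevance.
Qed.

Lemma class_eq x y : R x y -> class x = class y.
Proof. by move=> /canon_eq xy; rewrite -(class_rep (class x)) /= -(class_rep (class y)) /= xy. Qed.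

Lemma eq_class x y : class x = class y -> R x y.
Proof.
move=> xy; apply: (R_trans _ _ _ (R_sym _ _ (rep_class x))).
by rewrite xy; apply: rep_class.
Qed.

End Quotient.

(** * Groups of differences of cancellative lattice-ordered monoids *)

Section Differences.

Context {M : Type} {add meet : M -> M -> M} {zero : M}.
Local Notation "x + y" := (add x y) (at level 50, left associativity).
Local Notation "x ∧ y" := (meet x y) (at level 40, left associativity).
Context (addA : forall x y z, x + (y + z) = x + y + z).
Context (addC : forall x y, x + y = y + x).
Context (addx0 : forall x, x + zero = x).
Context (addI : forall x y z, x + z = y + z -> x = y).
Context (meetA : forall x y z, x ∧ (y ∧ z) = x ∧ y ∧ z).
Context (meetC : forall x y, x ∧ y = y ∧ x).
Context (meetxx : forall x, x ∧ x = x).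
Context (add_meet : forall x y z, x + (y ∧ z) = (x + y) ∧ (x + z)).

Lemma monoid_addCA x y z : x + (y + z) = y + (x + z).
Proof. by rewrite !addA (addC x). Qed.

Lemma monoid_meet_add x y z : (x ∧ y) + z = (x + z) ∧ (y + z).
Proof. by rewrite !(addC _ z) add_meet. Qed.

(** Produces a proof that the right-nested sum [t] equals a sum headed by [x]; [add_ac] then matches
    two sums summand by summand. *)
Ltac bring x t :=
  match t with
  | add x _ => constr:(eq_refl t)
  | add ?y x => constr:(addC y x)
  | add ?y ?r => let e := bring x r in
                 constr:(eq_trans (f_equal (add y) e) (monoid_addCA y x _))
  end.
Ltac add_ac :=
  rewrite -?addA;
  repeat match goal with
  | |- ?r = ?r => reflexivity
  | |- add ?x ?a = ?r => let e := bring x r in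
      refine (eq_trans _ (eq_sym e)); apply (f_equal (add x))
  end.

(** * Formal differences of pairs *)

Definition pair_eq (p q : M * M) := fst p + snd q = fst q + snd p.

Lemma pair_eq_refl p : pair_eq p p.
Proof. by []. Qed.

Lemma pair_eq_sym p q : pair_eq p q -> pair_eq q p.
Proof. by rewrite /pair_eq => ->. Qed.

Lemma pair_eq_trans p q r : pair_eq p q -> pair_eq q r -> pair_eq p r.
Proof.
rewrite /pair_eq => pq qr; apply: (addI _ _ (fst q + snd q)).
transitivity ((fst p + snd q) + (fst q + snd r)); first by add_ac.
by rewrite pq qr; add_ac.
Qed.

Definition pair_add (p q : M * M) := (fst p + fst q, snd p + snd q).
Definition pair_opp (p : M * M) := (snd p, fst p).
(** Both differences are first rewritten with the common subtrahend [snd p + snd q]. *)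
Definition pair_meet (p q : M * M) :=
  ((fst p + snd q) ∧ (fst q + snd p), snd p + snd q).

Lemma pair_add_eq p p' q q' :
  pair_eq p p' -> pair_eq q q' -> pair_eq (pair_add p q) (pair_add p' q').
Proof.
rewrite /pair_eq /= => pp qq.
transitivity ((fst p + snd p') + (fst q + snd q')); first by add_ac.
by rewrite pp qq; add_ac.
Qed.

Lemma pair_opp_eq p p' : pair_eq p p' -> pair_eq (pair_opp p) (pair_opp p').
Proof. by rewrite /pair_eq /= => pp; rewrite addC -pp addC. Qed.

Lemma pair_meetC p q : pair_meet p q = pair_meet q p.
Proof. by rewrite /pair_meet meetC (addC (snd p)). Qed.

Lemma pair_meet_eq p p' q q' :
  pair_eq p p' -> pair_eq q q' -> pair_eq (pair_meet p q) (pair_meet p' q').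
Proof.
have half a b c : pair_eq a b -> pair_eq (pair_meet a c) (pair_meet b c).
  rewrite /pair_eq /= => ab; rewrite !monoid_meet_add; congr (_ ∧ _); last by add_ac.
  transitivity ((fst a + snd b) + (snd c + snd c)); first by add_ac.
  by rewrite ab; add_ac.
move=> pp qq; apply: (pair_eq_trans _ _ _ (half _ _ q pp)).
by rewrite !(pair_meetC p'); apply: half.
Qed.

Local Notation diff := (quotient pair_eq (zero, zero)).
Local Notation cls := (class pair_eq (zero, zero) pair_eq_refl pair_eq_sym pair_eq_trans).
Local Notation rep := (rep pair_eq (zero, zero)).

Definition diff_add (g h : diff) : diff := cls (pair_add (rep g) (rep h)).
Definition diff_opp (g : diff) : diff := cls (pair_opp (rep g)).
Definition diff_meet (g h : diff) : diff := cls (pair_meet (rep g) (rep h)).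
Definition diff_of (x : M) : diff := cls (x, zero).

Lemma diff_addE p q : diff_add (cls p) (cls q) = cls (pair_add p q).
Proof. by apply: class_eq; apply: pair_add_eq; apply: rep_class. Qed.

Lemma diff_oppE p : diff_opp (cls p) = cls (pair_opp p).
Proof. by apply: class_eq; apply: pair_opp_eq; apply: rep_class. Qed.

Lemma diff_meetE p q : diff_meet (cls p) (cls q) = cls (pair_meet p q).
Proof. by apply: class_eq; apply: pair_meet_eq; apply: rep_class. Qed.

Lemma diff_ind (P : diff -> Prop) : (forall p, P (cls p)) -> forall g, P g.
Proof.
by move=> Pcls g; rewrite -(class_rep _ _ pair_eq_refl pair_eq_sym pair_eq_trans g).
Qed.

Lemma diff_ofD x y : diff_of (x + y) = diff_add (diff_of x) (diff_of y).
Proof. by rewrite diff_addE /pair_add /= addx0. Qed.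

Lemma diff_ofI x y : diff_of (x ∧ y) = diff_meet (diff_of x) (diff_of y).
Proof. by rewrite diff_meetE /pair_meet /= !addx0. Qed.

Lemma diff_of_inj x y : diff_of x = diff_of y -> x = y.
Proof. by move=> xy; have := eq_class _ _ _ _ _ _ _ xy; rewrite /pair_eq /= !addx0. Qed.

Lemma positive_of_monoid_embedding (A : Type)
    (aoplus aodot ajoin ameet : A -> A -> A) (azero aone : A) (f : A -> M) :
  (forall x y, f x = f y -> x = y) ->
  (forall x, zero ∧ f x = zero) ->
  (forall x, f x ∧ f aone = f x) ->
  f azero = zero ->
  (forall x y, f (aoplus x y) = (f x + f y) ∧ f aone) ->
  (forall x y, f x + f y = f (aoplus x y) + f (aodot x y)) ->
  (forall x y, f (ameet x y) = f x ∧ f y) ->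
  (forall x y, f x + f y = f (ajoin x y) + f (ameet x y)) ->
  positive_MV_algebra aoplus aodot ajoin ameet azero aone.
Proof.
move=> f_inj f_ge0 f_le1 f0 fD fDM fI fUI.
apply: (positive_of_group_embedding (add := diff_add) (opp := diff_opp)
          (meet := diff_meet) (zero := diff_of zero) (u := diff_of (f aone))
          _ _ _ _ _ _ _ _ _ _ _ _ _ _ _ _ (fun x => diff_of (f x))).
- move=> x y z; move: x y z.
  do 3 (apply: diff_ind => ?); rewrite !diff_addE; congr class.
  by rewrite /pair_add /= !addA.
- do 2 (apply: diff_ind => ?); rewrite !diff_addE; congr class.
  by rewrite /pair_add addC (addC (snd _)).
- by apply: diff_ind => -[x y]; rewrite diff_addE /pair_add /= !addx0.
- apply: diff_ind => p; rewrite diff_oppE diff_addE; apply: class_eq.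
  by rewrite /pair_eq /= addx0 (addC zero) addx0 addC.
- do 3 (apply: diff_ind => ?); rewrite !diff_meetE; congr class.
  rewrite /pair_meet /= !monoid_meet_add meetA; congr pair; last by add_ac.
  by congr (_ ∧ _); [congr (_ ∧ _)|]; add_ac.
- by do 2 (apply: diff_ind => ?); rewrite !diff_meetE pair_meetC.
- apply: diff_ind => p; rewrite diff_meetE; apply: class_eq.
  by rewrite /pair_eq /= meetxx; add_ac.
- do 3 (apply: diff_ind => ?); rewrite !(diff_addE, diff_meetE); apply: class_eq.
  by rewrite /pair_eq /= !(monoid_meet_add, add_meet); congr (_ ∧ _); add_ac.
- by rewrite -diff_ofI f_ge0.
- by move=> x y /diff_of_inj/f_inj.
- by move=> x; split; rewrite -diff_ofI ?f_ge0 ?f_le1.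
- by rewrite f0.
- by [].
- by move=> x y; rewrite fD diff_ofI diff_ofD.
- by move=> x y; rewrite -!diff_ofD fDM.
- by move=> x y; rewrite fI diff_ofI.
- by move=> x y; rewrite -!diff_ofD fUI.
Qed.

End Differences.

(** * Good sequences in an MV-monoidal algebra *)

Section GoodSequences.

Context {A : Type} {oplus odot join meet : A -> A -> A} {zero one : A}.
Context (mvm : is_MV_monoidal oplus odot join meet zero one).
Local Notation "x ⊕ y" := (oplus x y) (at level 50, left associativity).
Local Notation "x ⊙ y" := (odot x y) (at level 40, left associativity).
Local Notation "x ∨ y" := (join x y) (at level 50, left associativity).
Local Notation "x ∧ y" := (meet x y) (at level 40, left associativity).

Lemma mvm_joinA x y z : x ∨ (y ∨ z) = x ∨ y ∨ z.
Proof. by case: mvm. Qed.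
Lemma mvm_joinC x y : x ∨ y = y ∨ x.
Proof. by move: mvm; do 2 case=> _; case. Qed.
Lemma mvm_meetA x y z : x ∧ (y ∧ z) = x ∧ y ∧ z.
Proof. by move: mvm; do 1 case=> _; case. Qed.
Lemma mvm_meetC x y : x ∧ y = y ∧ x.
Proof. by move: mvm; do 3 case=> _; case. Qed.
Lemma mvm_joinKI x y : x ∨ x ∧ y = x.
Proof. by move: mvm; do 4 case=> _; case. Qed.
Lemma mvm_meetKU x y : x ∧ (x ∨ y) = x.
Proof. by move: mvm; do 5 case=> _; case. Qed.
Lemma mvm_addA x y z : x ⊕ (y ⊕ z) = x ⊕ y ⊕ z.
Proof. by move: mvm; do 7 case=> _; case. Qed.
Lemma mvm_addC x y : x ⊕ y = y ⊕ x.
Proof. by move: mvm; do 8 case=> _; case. Qed.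
Lemma mvm_addx0 x : x ⊕ zero = x.
Proof. by move: mvm; do 9 case=> _; case. Qed.
Lemma mvm_mulA x y z : x ⊙ (y ⊙ z) = x ⊙ y ⊙ z.
Proof. by move: mvm; do 10 case=> _; case. Qed.
Lemma mvm_mulC x y : x ⊙ y = y ⊙ x.
Proof. by move: mvm; do 11 case=> _; case. Qed.
Lemma mvm_mulx1 x : x ⊙ one = x.
Proof. by move: mvm; do 12 case=> _; case. Qed.
Lemma mvm_addU x y z : x ⊕ (y ∨ z) = (x ⊕ y) ∨ (x ⊕ z).
Proof. by move: mvm; do 13 case=> _; case. Qed.
Lemma mvm_addI x y z : x ⊕ (y ∧ z) = (x ⊕ y) ∧ (x ⊕ z).
Proof. by move: mvm; do 14 case=> _; case. Qed.
Lemma mvm_mulU x y z : x ⊙ (y ∨ z) = (x ⊙ y) ∨ (x ⊙ z).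
Proof. by move: mvm; do 15 case=> _; case. Qed.
Lemma mvm_mulI x y z : x ⊙ (y ∧ z) = (x ⊙ y) ∧ (x ⊙ z).
Proof. by move: mvm; do 16 case=> _; case. Qed.
Lemma mvm_E4 x y z : (x ⊕ y) ⊙ (x ⊙ y ⊕ z) = x ⊙ (y ⊕ z) ⊕ y ⊙ z.
Proof. by move: mvm; do 17 case=> _; case. Qed.
Lemma mvm_E5 x y z : x ⊙ y ⊕ (x ⊕ y) ⊙ z = (x ⊕ y ⊙ z) ⊙ (y ⊕ z).
Proof. by move: mvm; do 18 case=> _; case. Qed.
Lemma mvm_E6 x y z : x ⊙ y ⊕ z = (x ⊕ y) ⊙ (x ⊙ y ⊕ z) ∨ z.
Proof. by move: mvm; do 19 case=> _; case. Qed.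
Lemma mvm_E7 x y z : (x ⊕ y) ⊙ z = (x ⊙ y ⊕ (x ⊕ y) ⊙ z) ∧ z.
Proof. by move: mvm; do 20 case=> _. Qed.

(** * The order of an MV-monoidal algebra *)

Definition mvm_le x y := x ∧ y = x.
Local Notation "x ≤ y" := (mvm_le x y) (at level 70, no associativity).

Lemma mvm_meetxx x : x ∧ x = x.
Proof. by rewrite -{2}(mvm_joinKI x x) mvm_meetKU. Qed.

Lemma mvm_lexx x : x ≤ x.
Proof. exact: mvm_meetxx. Qed.

Lemma mvm_le_anti x y : x ≤ y -> y ≤ x -> x = y.
Proof. by rewrite /mvm_le => xy; rewrite mvm_meetC xy. Qed.

Lemma mvm_le_trans y x z : x ≤ y -> y ≤ z -> x ≤ z.
Proof. by rewrite /mvm_le => <- yz; rewrite -mvm_meetA yz. Qed.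

Lemma mvm_le_joinl x y : x ≤ x ∨ y.
Proof. exact: mvm_meetKU. Qed.

Lemma mvm_le_joinr x y : y ≤ x ∨ y.
Proof. by rewrite mvm_joinC; apply: mvm_le_joinl. Qed.

Lemma mvm_meet_lel x y : x ∧ y ≤ x.
Proof. by rewrite /mvm_le mvm_meetC mvm_meetA mvm_meetxx. Qed.

Lemma mvm_meet_ler x y : x ∧ y ≤ y.
Proof. by rewrite /mvm_le -mvm_meetA mvm_meetxx. Qed.

Lemma mvm_le_meet x y z : z ≤ x -> z ≤ y -> z ≤ x ∧ y.
Proof. by rewrite /mvm_le mvm_meetA => -> ->. Qed.

Lemma mvm_join_idPl x y : y ≤ x -> x ∨ y = x.
Proof. by rewrite /mvm_le mvm_meetC => <-; rewrite mvm_joinKI. Qed.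

Lemma mvm_join_le x y z : x ≤ z -> y ≤ z -> x ∨ y ≤ z.
Proof.
move=> /mvm_join_idPl xz /mvm_join_idPl yz; rewrite -yz -{1}xz -mvm_joinA.
exact: mvm_le_joinr.
Qed.

Lemma mvm_add_le x x' y y' : x ≤ x' -> y ≤ y' -> x ⊕ y ≤ x' ⊕ y'.
Proof.
move=> xx yy; apply: (mvm_le_trans (x ⊕ y')).
  by rewrite /mvm_le -mvm_addI yy.
by rewrite /mvm_le !(mvm_addC _ y') -mvm_addI xx.
Qed.

Lemma mvm_mul_le x x' y y' : x ≤ x' -> y ≤ y' -> x ⊙ y ≤ x' ⊙ y'.
Proof.
move=> xx yy; apply: (mvm_le_trans (x ⊙ y')).
  by rewrite /mvm_le -mvm_mulI yy.
by rewrite /mvm_le !(mvm_mulC _ y') -mvm_mulI xx.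
Qed.

(** Axiom (E6) with [one] for [y] exhibits [x ⊕ z] as a join with [z]. *)
Lemma mvm_le_addl x z : z ≤ x ⊕ z.
Proof.
have := mvm_E6 x one z; rewrite mvm_mulx1 => ->; exact: mvm_le_joinr.
Qed.

Lemma mvm_mul_ler x z : x ⊙ z ≤ z.
Proof.
have := mvm_E7 x zero z; rewrite mvm_addx0 => ->; exact: mvm_meet_ler.
Qed.

Lemma mvm_le_addr x z : z ≤ z ⊕ x.
Proof. by rewrite mvm_addC; apply: mvm_le_addl. Qed.

Lemma mvm_mul_lel x z : z ⊙ x ≤ z.
Proof. by rewrite mvm_mulC; apply: mvm_mul_ler. Qed.

Lemma mvm_le0x x : zero ≤ x.
Proof. by have := mvm_le_addl x zero; rewrite mvm_addx0. Qed.

Lemma mvm_lex1 x : x ≤ one.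
Proof. by have := mvm_mul_ler x one; rewrite mvm_mulx1. Qed.

Lemma mvm_add1x x : one ⊕ x = one.
Proof. exact: mvm_le_anti (mvm_lex1 _) (mvm_le_addr _ _). Qed.

Lemma mvm_mul0x x : zero ⊙ x = zero.
Proof. exact: mvm_le_anti (mvm_mul_lel _ _) (mvm_le0x _). Qed.

Lemma mvm_mul1x x : one ⊙ x = x.
Proof. by rewrite mvm_mulC mvm_mulx1. Qed.

Lemma mvm_add0x x : zero ⊕ x = x.
Proof. by rewrite mvm_addC mvm_addx0. Qed.

(* The middle term of [x + y + z], i.e. the truncation of [x + y + z - 1]. *)
Definition sigma x y z := x ⊙ y ⊕ (x ⊕ y) ⊙ z.

(** (E4) and (E5) pass between the two forms, each time rotating the variables by one place; using
    (E5), (E4), (E5) completes the cycle. *)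
Lemma sigmaE x y z : sigma x y z = (x ⊕ y) ⊙ (x ⊙ y ⊕ z).
Proof.
have E4 a b c : (a ⊕ b) ⊙ (a ⊙ b ⊕ c) = sigma b c a.
  by rewrite mvm_E4 mvm_addC /sigma (mvm_mulC a).
have E5 a b c : sigma a b c = (b ⊕ c) ⊙ (b ⊙ c ⊕ a).
  by rewrite /sigma mvm_E5 mvm_mulC (mvm_addC a).
by rewrite E5 E4 E5.
Qed.

(** A rotation and the evident symmetry in the first two arguments generate all permutations. *)
Lemma sigmaC x y z : sigma x y z = sigma x z y.
Proof.
have rot a b c : sigma a b c = sigma b c a.
  by rewrite sigmaE mvm_E4 mvm_addC /sigma (mvm_mulC a).
by rewrite rot rot /sigma mvm_addC (mvm_mulC z) (mvm_addC z) mvm_addC.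
Qed.

(** * Good pairs: insertion and meets *)

Definition good_pair p q := p ⊕ q = p /\ p ⊙ q = q.

Lemma good_pair1 q : good_pair one q.
Proof. by split; [apply: mvm_add1x | apply: mvm_mul1x]. Qed.

Lemma good_pair0 p : good_pair p zero.
Proof. by split; [apply: mvm_addx0 | rewrite mvm_mulC mvm_mul0x]. Qed.

(** The two forms of [sigma x y z] are compared at [z = one] and at [z = zero]. *)
Lemma good_pair_add_mul x y : good_pair (x ⊕ y) (x ⊙ y).
Proof.
split.
- have := sigmaE x y one; rewrite /sigma !mvm_mulx1 (mvm_addC (x ⊙ y)) => ->.
  by rewrite (mvm_addC _ one) mvm_add1x mvm_mulx1.
- have := sigmaE x y zero; rewrite /sigma mvm_addx0 => <-.
  by rewrite (mvm_mulC _ zero) mvm_mul0x mvm_addx0.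
Qed.

Lemma good_pair_assoc p q z : good_pair p q -> p ⊙ (q ⊕ z) = q ⊕ p ⊙ z.
Proof. by case=> pq qp; have := sigmaE p q z; rewrite /sigma pq qp => <-. Qed.

(** Together with [good_pair_mul], this recovers information about the old terms from [q ⊕ p ⊙ z],
    the term obtained by inserting [z]. *)
Lemma good_pair_add p q z : good_pair p q -> q ⊕ z = (q ⊕ p ⊙ z) ∨ z.
Proof.
move=> pq; have := mvm_E6 p q z; case: (pq) => -> ->.
by rewrite (good_pair_assoc _ _ _ pq).
Qed.

Lemma good_pair_mul p q z : good_pair p q -> p ⊙ z = (q ⊕ p ⊙ z) ∧ z.
Proof. by move=> pq; have := mvm_E7 p q z; case: pq => -> ->. Qed.

(** Absorption reduces the first claim to [good_pair_add_mul] for [q] and [p ⊙ a], and the second to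
    the same lemma for [q] and [r ⊕ a]. *)
Lemma good_pair_insert p q r a :
  good_pair p q -> good_pair q r -> good_pair (q ⊕ p ⊙ a) (r ⊕ q ⊙ a).
Proof.
move=> pq qr; have [pqA pqM] := pq; have [qrA qrM] := qr; split.
- have -> : q ⊙ a = q ⊙ (p ⊙ a) by rewrite mvm_mulA (mvm_mulC q p) pqM.
  rewrite mvm_addA (mvm_addC _ r) mvm_addA (mvm_addC r) qrA.
  by case: (good_pair_add_mul q (p ⊙ a)).
- rewrite -(good_pair_assoc _ _ a pq) -(good_pair_assoc _ _ a qr).
  have -> : q ⊕ a = q ⊕ (r ⊕ a) by rewrite mvm_addA qrA.
  rewrite -mvm_mulA; case: (good_pair_add_mul q (r ⊕ a)) => _ ->.
  by rewrite mvm_mulA pqM.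
Qed.

Lemma good_pair_meet p q p' q' :
  good_pair p q -> good_pair p' q' -> good_pair (p ∧ p') (q ∧ q').
Proof.
move=> pq pq'; have [pqA pqM] := pq; have [pqA' pqM'] := pq'; split.
- apply: mvm_le_anti (mvm_le_addr _ _); apply: mvm_le_meet.
  + rewrite -[X in _ ≤ X]pqA; apply: mvm_add_le; exact: mvm_meet_lel.
  + rewrite -[X in _ ≤ X]pqA'; apply: mvm_add_le; exact: mvm_meet_ler.
(* This bounds the mixed products [p ⊙ q'] and [p' ⊙ q] from below; the unmixed ones are [q] and
   [q']. *)
- have meet_le a b c d : good_pair a b -> b ∧ d ≤ a ⊙ d.
    move=> ab; rewrite (good_pair_mul _ _ d ab).
    apply: mvm_le_meet (mvm_meet_ler _ _); apply: mvm_le_trans (mvm_le_addr _ _).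
    exact: mvm_meet_lel.
  apply: mvm_le_anti (mvm_mul_ler _ _) _.
  rewrite mvm_mulI !(mvm_mulC (p ∧ p')) !mvm_mulI !(mvm_mulC q) !(mvm_mulC q').
  rewrite pqM pqM'; apply: mvm_le_meet; apply: mvm_le_meet.
  + exact: mvm_meet_lel.
  + by rewrite mvm_meetC; apply: meet_le.
  + exact: meet_le.
  + exact: mvm_meet_ler.
Qed.

Lemma good_pair_insert_meet p q p' q' a :
  good_pair p q -> good_pair p' q' ->
  (q ∧ q') ⊕ (p ∧ p') ⊙ a = (q ⊕ p ⊙ a) ∧ (q' ⊕ p' ⊙ a).
Proof.
move=> pq pq'; apply: mvm_le_anti.
  apply: mvm_le_meet; apply: mvm_add_le; try apply: mvm_mul_le (mvm_lexx _);
    solve [exact: mvm_meet_lel | exact: mvm_meet_ler].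
(* Written as a product by [good_pair_assoc], the left side expands into a meet of four terms. The
   two mixed ones are bounded here through (E7). *)
have cross x y x' y' : good_pair x y -> good_pair x' y' ->
    (y ⊕ x ⊙ a) ∧ (y' ⊕ x' ⊙ a) ≤ x ⊙ (y' ⊕ a).
  move=> xy xy'; rewrite (good_pair_mul _ _ (y' ⊕ a) xy); apply: mvm_le_meet.
    apply: mvm_le_trans (mvm_meet_lel _ _) _; apply: mvm_add_le (mvm_lexx _) _.
    exact: mvm_mul_le (mvm_lexx _) (mvm_le_addl _ _).
  apply: mvm_le_trans (mvm_meet_ler _ _) _; apply: mvm_add_le (mvm_lexx _) _.
  exact: mvm_mul_ler.
rewrite -(good_pair_assoc _ _ a (good_pair_meet _ _ _ _ pq pq')).
rewrite mvm_mulC (mvm_addC _ a) mvm_addI !(mvm_addC a) mvm_mulC mvm_mulI.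
rewrite !(mvm_mulC (p ∧ p')) !mvm_mulI !(mvm_mulC (_ ⊕ _)).
apply: mvm_le_meet; apply: mvm_le_meet.
- by rewrite (good_pair_assoc _ _ _ pq); apply: mvm_meet_lel.
- by rewrite mvm_meetC; apply: cross.
- exact: cross.
- by rewrite (good_pair_assoc _ _ _ pq'); apply: mvm_meet_ler.
Qed.

(* [pre s k] is the term of index [k - 1], a good sequence being preceded by ones. *)
Definition pre (s : nat -> A) k := match k with 0 => one | S k => s k end.

Definition good s := forall k, good_pair (pre s k) (s k).

Definition insert a (s : nat -> A) k := s k ⊕ pre s k ⊙ a.

Lemma pre_good s : good s -> good (pre s).
Proof. by move=> sP [|k]; [apply: good_pair1 | apply: sP]. Qed.

(** Insertion commutes with the shift because the preceding [one] absorbs every summand. *)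
Lemma pre_insert a s k : pre (insert a s) k = insert a (pre s) k.
Proof. by case: k => //=; rewrite /insert /= mvm_add1x. Qed.

Lemma insert_good a s : good s -> good (insert a s).
Proof.
by move=> sP k; rewrite pre_insert; apply: good_pair_insert (sP k); apply: pre_good.
Qed.

(** A double insertion at [k] depends on the new summands only through [sigma (pre s k) d c], which
    is symmetric in them. *)
Lemma insertC a b s : good s -> insert a (insert b s) = insert b (insert a s).
Proof.
move=> sP; apply: functional_extensionality => k.
have E c d : insert c (insert d s) k =
    s k ⊕ pre (pre s) k ⊙ sigma (pre s k) d c.
  have pq := pre_good _ sP k.
  rewrite {1}/insert pre_insert /insert -mvm_addA; congr (_ ⊕ _).
  rewrite -(good_pair_assoc _ _ _ pq) -mvm_mulA -good_pair_assoc //.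
  (* The pair stays good when its second entry is multiplied by [d], since the first entry still
     absorbs the smaller element. *)
  have [pqA pqM] := pq; split; last by rewrite mvm_mulA pqM.
  apply: mvm_le_anti (mvm_le_addr _ _); rewrite -[X in _ ≤ X]pqA.
  by apply: mvm_add_le (mvm_lexx _) _; apply: mvm_mul_lel.
by rewrite !E sigmaC.
Qed.

(* [s k ⊕ a] and [s k ⊙ a] can be read off [insert a s]: this is where the
   cancellation property is used. *)
Lemma insert_inj a s t :
  (forall x y z, x ⊕ z = y ⊕ z -> x ⊙ z = y ⊙ z -> x = y) ->
  good s -> good t -> insert a s = insert a t -> s = t.
Proof.
move=> cancel sP tP st; apply: functional_extensionality => k.
apply: (cancel _ _ a).
- rewrite (good_pair_add _ _ a (sP k)) (good_pair_add _ _ a (tP k)).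
  by congr (_ ∨ _); apply: (f_equal (fun w => w k) st).
- rewrite (good_pair_mul _ _ a (sP (S k))) (good_pair_mul _ _ a (tP (S k))).
  by congr (_ ∧ _); apply: (f_equal (fun w => w (S k)) st).
Qed.

Definition seq_meet (s t : nat -> A) k := s k ∧ t k.

Lemma pre_meet s t k : pre (seq_meet s t) k = pre s k ∧ pre t k.
Proof. by case: k => //=; rewrite mvm_meetxx. Qed.

Lemma good_meet s t : good s -> good t -> good (seq_meet s t).
Proof. by move=> sP tP k; rewrite pre_meet; apply: good_pair_meet. Qed.

Lemma insert_meet a s t : good s -> good t ->
  insert a (seq_meet s t) = seq_meet (insert a s) (insert a t).
Proof.
move=> sP tP; apply: functional_extensionality => k.
by rewrite /insert pre_meet; apply: good_pair_insert_meet.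
Qed.

(** * Finite sums and their meets *)

Definition good_sum (l : list A) := fold_right insert (fun _ => zero) l.

Lemma fold_insert_good s l : good s -> good (fold_right insert s l).
Proof. by move=> sP; elim: l => //= a l; apply: insert_good. Qed.

Lemma good_sum_is_good l : good (good_sum l).
Proof. by apply: fold_insert_good => k; apply: good_pair0. Qed.

Lemma good_sum_perm l m : Permutation l m -> good_sum l = good_sum m.
Proof.
elim=> //= [a l' m' _ -> //|a b l'|l1 l2 l3 _ -> _ -> //].
exact/insertC/good_sum_is_good.
Qed.

Lemma good_sum_app l m : good_sum (l ++ m) = fold_right insert (good_sum m) l.
Proof. by rewrite /good_sum fold_right_app. Qed.

Lemma good_sum_app_eq l l' m m' :
  good_sum l = good_sum l' -> good_sum m = good_sum m' -> good_sum (l ++ m) = good_sum (l' ++ m').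
Proof.
move=> ll mm; rewrite good_sum_app mm -good_sum_app (good_sum_perm _ _ (Permutation_app_comm _ _)).
by rewrite good_sum_app ll -good_sum_app; apply/good_sum_perm/Permutation_app_comm.
Qed.

Lemma good_sum_app_inj l m m' :
  (forall x y z, x ⊕ z = y ⊕ z -> x ⊙ z = y ⊙ z -> x = y) ->
  good_sum (m ++ l) = good_sum (m' ++ l) -> good_sum m = good_sum m'.
Proof.
(* With [l] in front, its elements become the outermost insertions, and [insert_inj] strips them one
   by one. *)
move=> cancel; rewrite !(fun n => good_sum_perm _ _ (Permutation_app_comm n l)).
elim: l => //= a l IHl /(insert_inj _ _ _ cancel) E.
by apply: IHl; apply: E; apply: good_sum_is_good.
Qed.

Lemma good_sum_tail l k : length l <= k -> good_sum l k = zero.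
Proof.
elim: l k => //= a l IHl [|k] lk; first by lia.
by rewrite /insert /= !IHl ?mvm_add0x ?mvm_mul0x //; lia.
Qed.

Lemma good_absorb s k : good s -> s 0 ⊙ s (S k) = s (S k).
Proof.
move=> sP; elim: k => [|k IHk]; first by case: (sP 1).
by case: (sP (S (S k))) => _ /= <-; rewrite mvm_mulA IHk.
Qed.

(** A finitely supported good sequence is the sum of its own terms: inserting [s 0] into the shifted
    sequence gives back [s], since each term absorbs its successor. *)
Lemma good_sum_map_seq s n :
  good s -> (forall k, n <= k -> s k = zero) -> good_sum (map s (seq 0 n)) = s.
Proof.
elim: n s => [|n IHn] s sP s0.
  by apply: functional_extensionality => k; rewrite s0 //; lia.
have s'P : good (fun k => s (S k)) by case=> [|k]; [apply: good_pair1 | apply: (sP (S (S k)))].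
rewrite /= -seq_shift map_map IHn //; first by move=> k nk; apply: s0; lia.
apply: functional_extensionality => -[|k]; rewrite /insert /=.
- by rewrite mvm_mul1x mvm_addC; case: (sP 1).
- by rewrite mvm_mulC good_absorb // mvm_addC; case: (sP (S (S k))).
Qed.

(** The first [length l] terms suffice, as [good_sum l] vanishes from there on and [zero] is
    least. *)
Definition list_meet l m := map (seq_meet (good_sum l) (good_sum m)) (seq 0 (length l)).

Lemma good_sum_list_meet l m : good_sum (list_meet l m) = seq_meet (good_sum l) (good_sum m).
Proof.
apply: good_sum_map_seq; first by apply: good_meet; apply: good_sum_is_good.
by move=> k lk; rewrite /seq_meet good_sum_tail //; apply: mvm_le0x.
Qed.

Lemma good_sum_app_meet l m m' :
  good_sum (l ++ list_meet m m') = seq_meet (good_sum (l ++ m)) (good_sum (l ++ m')).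
Proof.
elim: l => [|a l IHl] /=; first exact: good_sum_list_meet.
by rewrite IHl insert_meet //; apply: good_sum_is_good.
Qed.

Lemma good_sum_pair x y :
  good_sum [x; y] = fun k => match k with 0 => x ⊕ y | 1 => x ⊙ y | _ => zero end.
Proof.
apply: functional_extensionality => -[|[|k]]; rewrite /= /insert /=.
- by rewrite !mvm_mul1x mvm_add0x mvm_addC.
- by rewrite mvm_mul1x mvm_mul0x !mvm_add0x mvm_mulC.
- by rewrite !mvm_mul0x !mvm_add0x mvm_mul0x.
Qed.

Lemma good_sum_single x : good_sum [x] = fun k => match k with 0 => x | _ => zero end.
Proof.
apply: functional_extensionality => -[|k]; rewrite /= /insert /=.
- by rewrite mvm_mul1x mvm_add0x.
- by rewrite mvm_mul0x mvm_add0x.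
Qed.

(** With [join_mul_meet], this makes [[x ∨ y; x ∧ y]] and [[x; y]] have the same sum. *)
Lemma join_add_meet x y : (x ∨ y) ⊕ (x ∧ y) = x ⊕ y.
Proof.
apply: mvm_le_anti.
- rewrite mvm_addC mvm_addU mvm_addC (mvm_addC _ y); apply: mvm_join_le.
    exact: mvm_add_le (mvm_lexx _) (mvm_meet_ler _ _).
  by rewrite mvm_addC; apply: mvm_add_le (mvm_meet_lel _ _) (mvm_lexx _).
- rewrite mvm_addI; apply: mvm_le_meet.
    by rewrite (mvm_addC _ x); apply: mvm_add_le (mvm_lexx _) (mvm_le_joinr _ _).
  exact: mvm_add_le (mvm_le_joinl _ _) (mvm_lexx _).
Qed.

Lemma join_mul_meet x y : (x ∨ y) ⊙ (x ∧ y) = x ⊙ y.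
Proof.
apply: mvm_le_anti.
- rewrite mvm_mulC mvm_mulU mvm_mulC (mvm_mulC _ y); apply: mvm_join_le.
    exact: mvm_mul_le (mvm_lexx _) (mvm_meet_ler _ _).
  by rewrite mvm_mulC; apply: mvm_mul_le (mvm_meet_lel _ _) (mvm_lexx _).
- rewrite mvm_mulI; apply: mvm_le_meet.
    by rewrite (mvm_mulC _ x); apply: mvm_mul_le (mvm_lexx _) (mvm_le_joinr _ _).
  exact: mvm_mul_le (mvm_le_joinl _ _) (mvm_lexx _).
Qed.

(** * The monoid of sums and the embedding *)

Definition good_sum_eq (l m : list A) := good_sum l = good_sum m.

Lemma good_sum_eq_refl l : good_sum_eq l l.
Proof. by []. Qed.

Lemma good_sum_eq_sym l m : good_sum_eq l m -> good_sum_eq m l.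
Proof. by []. Qed.

Lemma good_sum_eq_trans l m n : good_sum_eq l m -> good_sum_eq m n -> good_sum_eq l n.
Proof. by rewrite /good_sum_eq => ->. Qed.

Local Notation monoid := (quotient good_sum_eq []).
Local Notation cls := (class good_sum_eq [] good_sum_eq_refl good_sum_eq_sym good_sum_eq_trans).
Local Notation rep := (rep good_sum_eq []).

(** Working with lists modulo equal sums, rather than with sequences, makes addition a
    concatenation, so associativity comes from lists. *)
Definition monoid_add (x y : monoid) : monoid := cls (rep x ++ rep y).
Definition monoid_meet (x y : monoid) : monoid := cls (list_meet (rep x) (rep y)).

Lemma monoid_addE l m : monoid_add (cls l) (cls m) = cls (l ++ m).
Proof. by apply: class_eq; apply: good_sum_app_eq; apply: (rep_class good_sum_eq). Qed.

Lemma monoid_meetE l m : monoid_meet (cls l) (cls m) = cls (list_meet l m).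
Proof.
apply: class_eq; rewrite /good_sum_eq !good_sum_list_meet.
by congr seq_meet; apply: (rep_class good_sum_eq).
Qed.

Lemma monoid_ind (P : monoid -> Prop) : (forall l, P (cls l)) -> forall x, P x.
Proof.
by move=> Pcls x; rewrite -(class_rep _ _ good_sum_eq_refl good_sum_eq_sym good_sum_eq_trans x).
Qed.

Lemma cancellative_positive :
  (forall x y z, x ⊕ z = y ⊕ z -> x ⊙ z = y ⊙ z -> x = y) ->
  positive_MV_algebra oplus odot join meet zero one.
Proof.
move=> cancel.
apply: (positive_of_monoid_embedding (add := monoid_add) (meet := monoid_meet)
          (zero := cls []) _ _ _ _ _ _ _ _ _ _ _ _ _ _ _ (fun x => cls [x])).
- by do 3 (apply: monoid_ind => ?); rewrite !monoid_addE app_assoc.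
- do 2 (apply: monoid_ind => ?); rewrite !monoid_addE; apply: class_eq.
  exact/good_sum_perm/Permutation_app_comm.
- by apply: monoid_ind => l; rewrite monoid_addE app_nil_r.
- move=> x y z; move: x y z; do 3 (apply: monoid_ind => ?); rewrite !monoid_addE => E.
  have {E} := eq_class _ _ _ _ _ _ _ E.
  by move=> /(good_sum_app_inj _ _ _ cancel) E; apply: class_eq.
- do 3 (apply: monoid_ind => ?); rewrite !monoid_meetE; apply: class_eq.
  rewrite /good_sum_eq !good_sum_list_meet.
  by apply: functional_extensionality => k; apply: mvm_meetA.
- do 2 (apply: monoid_ind => ?); rewrite !monoid_meetE; apply: class_eq.
  rewrite /good_sum_eq !good_sum_list_meet.
  by apply: functional_extensionality => k; apply: mvm_meetC.
- apply: monoid_ind => l; rewrite monoid_meetE; apply: class_eq.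
  rewrite /good_sum_eq !good_sum_list_meet.
  by apply: functional_extensionality => k; apply: mvm_meetxx.
- do 3 (apply: monoid_ind => ?); rewrite !(monoid_addE, monoid_meetE).
  by apply: class_eq; rewrite /good_sum_eq good_sum_list_meet good_sum_app_meet.
- move=> x y E; have := eq_class _ _ _ _ _ _ _ E.
  by rewrite /good_sum_eq !good_sum_single => /(f_equal (fun s => s 0)).
- by move=> x; rewrite monoid_meetE.
- move=> x; rewrite monoid_meetE; apply: class_eq; rewrite /good_sum_eq good_sum_list_meet.
  rewrite !good_sum_single; apply: functional_extensionality => -[|k]; first exact: mvm_lex1.
  exact: mvm_meetxx.
- apply: class_eq; rewrite /good_sum_eq good_sum_single.
  by apply: functional_extensionality => -[|k].
(* The meet of [x ⊕ y, x ⊙ y, zero, ...] with [one, zero, ...] keeps only the first term. *)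
- move=> x y; rewrite monoid_addE monoid_meetE; apply: class_eq.
  rewrite /good_sum_eq good_sum_list_meet good_sum_pair !good_sum_single.
  apply: functional_extensionality => -[|[|k]] /=; symmetry; first exact: mvm_lex1.
  + by rewrite /seq_meet mvm_meetC; apply: mvm_le0x.
  + exact: mvm_meetxx.
(* The terms [x ⊕ y] and [x ⊙ y] already form a good pair, so summing them again changes nothing. *)
- move=> x y; rewrite !monoid_addE; apply: class_eq; rewrite /good_sum_eq !good_sum_pair.
  apply: functional_extensionality => -[|[|k]] //; have [] := good_pair_add_mul x y.
    by move=> ->.
  by move=> _ ->.
- move=> x y; rewrite monoid_meetE; apply: class_eq.
  rewrite /good_sum_eq good_sum_list_meet !good_sum_single.
  by apply: functional_extensionality => -[|k] //; rewrite /seq_meet mvm_meetxx.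
- move=> x y; rewrite !monoid_addE; apply: class_eq; rewrite /good_sum_eq !good_sum_pair.
  by apply: functional_extensionality => -[|[|k]]; rewrite ?join_add_meet ?join_mul_meet.
Qed.

End GoodSequences.

Theorem theorem4 (A : Type) (oplus odot join meet : A -> A -> A) (zero one : A) :
  positive_MV_algebra oplus odot join meet zero one <->
  (is_MV_monoidal oplus odot join meet zero one /\
   (forall x y z : A, oplus x z = oplus y z -> odot x z = odot y z -> x = y)).
Proof.
split; last by case=> mvm cancel; apply: cancellative_positive.
case=> B [boplus [bneg [bzero [f [mvB [f_inj [fD [fM [fU [fI [f0 f1]]]]]]]]]]].
split; last first.
  move=> x y z xyD xyM; apply: f_inj; apply: (mv_add_mul_cancel mvB _ _ (f z)).
    by rewrite -!fD xyD.
  by rewrite -!fM xyM.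
have := mv_is_MV_monoidal mvB; rewrite /is_MV_monoidal => mvmB.
(* All the axioms are equations, so the injective homomorphism [f] reflects them to [A]. *)
by do !split; move=> *; apply: f_inj; rewrite ?(fD, fM, fU, fI, f0, f1); apply mvmB.
Qed.
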